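(* For positive integers $r,n$, define $$A_{n,r}(x,y,s,t,p,q)=\sum_{\pi^c\in\mathbb{Z}_r\wr\mathcal{S}_n}x^{\mathrm{exc}_B(\pi^c)}y^{\mathrm{aexc}(\pi^c)}s^{\mathrm{single}(\pi^c)}t^{\mathrm{fix}(\pi^c)}p^{\mathrm{csum}(\pi^c)}q^{\mathrm{cyc}(\pi^c)}.$$ Then $$A_{n,r}(x,y,s,t,p,q)=[r]_p^ny^nA_n\left(\frac{x}{y},\frac{t+sp[r-1]_p}{[r]_py},q\right).$$ In particular, $$\sum_{\pi^c\in\mathbb{Z}_r\wr\mathcal{S}_n}x^{\mathrm{exc}(\pi^c)}t^{\mathrm{fix}(\pi^c)}p^{\mathrm{csum}(\pi^c)}q^{\mathrm{cyc}(\pi^c)}=A_{n,r}(x,1,x,t,p,q)=[r]_p^nA_n\left(x,\frac{t+xp[r-1]_p}{[r]_p},q\right).$$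
   Context: $[m]_p=1+p+\cdots+p^{m-1}$ for $m\geqslant1$, $[0]_p=0$. $A_n(x,p,q)=\sum_{\pi\in\mathcal{S}_n}x^{\mathrm{exc}(\pi)}p^{\mathrm{fix}(\pi)}q^{\mathrm{cyc}(\pi)}$ with $\mathrm{exc}(\pi)=\#\{i:\pi(i)>i\}$, $\mathrm{fix}(\pi)=\#\{i:\pi(i)=i\}$, $\mathrm{cyc}$ the number of cycles. $\mathbb{Z}_r\wr\mathcal{S}_n$ is the set of $r$-colored permutations $\pi^c=\pi_1^{c_1}\cdots\pi_n^{c_n}$, $\pi\in\mathcal{S}_n$, $c_i\in\{0,\dots,r-1\}$. Statistics: $\mathrm{exc}_B(\pi^c)=\#\{i:\pi_i>i\}$; $\mathrm{aexc}(\pi^c)=\#\{i:\pi_i<i\}$; $\mathrm{single}(\pi^c)=\#\{i:\pi_i=i,\ c_i>0\}$; $\mathrm{fix}(\pi^c)=\#\{i:\pi_i=i,\ c_i=0\}$; $\mathrm{exc}(\pi^c)=\mathrm{exc}_B(\pi^c)+\mathrm{single}(\pi^c)$; $\mathrm{csum}(\pi^c)=\sum_i c_i$; $\mathrm{cyc}(\pi^c)$ is the number of cycles of $\pi$. *)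

(* Defs.v *)
From mathcomp Require Import all_boot all_order all_algebra all_fingroup.

Set Implicit Arguments.
Unset Strict Implicit.
Unset Printing Implicit Defensive.

Import GRing.Theory.
Local Open Scope ring_scope.

(* The p-analogue [m]_p of m. *)
Definition qnum (R : comNzRingType) (m : nat) (p : R) : R :=
  \sum_(i < m) p ^+ i.

Section PermutationStatistics.
Variables (n : nat) (pi : 'S_n).

Definition exc : nat := #|[set i : 'I_n | (i < pi i)%N]|.
Definition aexc : nat := #|[set i : 'I_n | (pi i < i)%N]|.
Definition fix_ : nat := #|[set i : 'I_n | pi i == i]|.
(* porbits includes the singleton orbits, so fixed points count as cycles. *)
Definition cyc : nat := #|porbits pi|.

End PermutationStatistics.

(* Polynomials in several variables are represented by their values at
   arbitrary elements of a commutative ring; indeterminates are recovered by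
   taking the variables of a polynomial ring (or of its fraction field). *)
Definition eulerA (R : comNzRingType) (n : nat) (x p q : R) : R :=
  \sum_(pi : 'S_n) x ^+ exc pi * p ^+ fix_ pi * q ^+ cyc pi.

(* An r-colored permutation of n letters: the underlying permutation, and the
   color c_i in {0, ..., r-1} carried by the letter pi_i in position i. *)
Definition cperm (r n : nat) : finType :=
  ('S_n * {ffun 'I_n -> 'I_r})%type.

Section ColoredStatistics.
Variables (r n : nat) (w : cperm r n).

Definition cexcB : nat := exc w.1.
Definition caexc : nat := aexc w.1.
Definition csingle : nat :=
  #|[set i : 'I_n | (w.1 i == i) && (0 < w.2 i)%N]|.
Definition cfix : nat :=
  #|[set i : 'I_n | (w.1 i == i) && (w.2 i == 0 :> nat)%N]|.
Definition cexc : nat := (cexcB + csingle)%N.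
Definition csum : nat := (\sum_(i < n) w.2 i)%N.
Definition ccyc : nat := cyc w.1.

End ColoredStatistics.

Definition coloredA (R : comNzRingType) (n r : nat) (x y s t p q : R) : R :=
  \sum_(w : cperm r n)
     x ^+ cexcB w * y ^+ caexc w * s ^+ csingle w * t ^+ cfix w
     * p ^+ csum w * q ^+ ccyc w.

(* Main.v *)
(* For a fixed permutation the colors are chosen independently: a fixed point
   contributes t (color 0) or s p^c (color c > 0), in total t + s p [r-1]_p,
   and any other position contributes [r]_p. The powers of [r]_p and y are
   then homogenized using exc + aexc + fix = n. *)

Require Import Defs.
From mathcomp Require Import all_boot all_order all_algebra all_fingroup.
From mathcomp Require Import ring.

Set Implicit Arguments.
Unset Strict Implicit.
Unset Printing Implicit Defensive.

Import GRing.Theory.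
Local Open Scope ring_scope.

(** Powers of statistics become products over positions, so that the weight of a colored permutation
    factors position by position. *)
Lemma expr_card_set (R : comNzRingType) (T : finType) (P : pred T) (a : R) :
  a ^+ #|[set i | P i]| = \prod_i (if P i then a else 1).
Proof.
by rewrite -prodr_const -big_mkcond; apply: eq_bigl => i; rewrite inE.
Qed.

(** By trichotomy of [pi i] and [i], each position is counted exactly once. *)
Lemma exc_aexc_fix (n : nat) (pi : 'S_n) : (exc pi + aexc pi + fix_ pi = n)%N.
Proof.
rewrite -[RHS]card_ord -sum1_card /exc /aexc /fix_ -!sum1dep_card.
rewrite big_mkcond [X in (_ + X + _)%N]big_mkcond [X in (_ + _ + X)%N]big_mkcond.
rewrite -!big_split /=; apply: eq_bigr => i _.
by rewrite -val_eqE /=; case: ltngtP.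
Qed.

Lemma fixed_color_sum (R : comNzRingType) (r : nat) (s t p : R) :
  \sum_(c < r.+1) (if (c == 0 :> nat)%N then t else s) * p ^+ c =
  t + s * p * qnum r p.
Proof.
rewrite big_ord_recl /= mulr1 mulr_sumr; congr (_ + _).
by apply: eq_bigr => i _; rewrite exprS mulrA.
Qed.

Lemma color_sum (R : comNzRingType) (r n : nat) (pi : 'S_n) (s t p : R) :
  \sum_(c : {ffun 'I_n -> 'I_r.+1})
     s ^+ csingle (pi, c) * t ^+ cfix (pi, c) * p ^+ csum (pi, c) =
  (t + s * p * qnum r p) ^+ fix_ pi * qnum r.+1 p ^+ (exc pi + aexc pi).
Proof.
(* [w i j] is the weight of position [i] carrying color [j]; a non-fixed position contributes only
   its color to [csum]. *)
pose w i (j : 'I_r.+1) : R :=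
  (if pi i == i then if (j == 0 :> nat)%N then t else s else 1) * p ^+ j.
transitivity (\sum_(c : {ffun 'I_n -> 'I_r.+1}) \prod_i w i (c i)).
  apply: eq_bigr => c _; rewrite !expr_card_set -prodrXr -!big_split /=.
  apply: eq_bigr => i _; rewrite /w lt0n; congr (_ * _).
  by case: (pi i == i); case: (_ == 0)%N; rewrite /= ?mulr1 ?mul1r.
(* Distributivity: the sum over colorings of a product over positions is the product over positions
   of sums over one color. *)
rewrite -bigA_distr_bigA exprD !expr_card_set -!big_split /=.
apply: eq_bigr => i _; rewrite -val_eqE /= /w -val_eqE /=.
case: ltngtP => _; rewrite ?mulr1 ?mul1r.
- by apply: eq_bigr => j _; rewrite mul1r.
- by apply: eq_bigr => j _; rewrite mul1r.
- exact: fixed_color_sum.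
Qed.

(** Division-free form, valid before homogenizing; with [r.+1] colors, [qnum r p] is the factor
    $[r-1]_p$ of the claim. *)
Lemma coloredA_sum_perm (R : comNzRingType) (n r : nat) (x y s t p q : R) :
  coloredA n r.+1 x y s t p q =
  \sum_(pi : 'S_n) x ^+ exc pi * y ^+ aexc pi
     * (t + s * p * qnum r p) ^+ fix_ pi
     * qnum r.+1 p ^+ (exc pi + aexc pi) * q ^+ cyc pi.
Proof.
rewrite /coloredA.
transitivity (\sum_(pi : 'S_n) \sum_(c : {ffun 'I_n -> 'I_r.+1})
   x ^+ exc pi * y ^+ aexc pi * q ^+ cyc pi *
   (s ^+ csingle (pi, c) * t ^+ cfix (pi, c) * p ^+ csum (pi, c))).
  rewrite pair_big /=; apply: eq_bigr => -[pi c] _.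
  by rewrite [RHS]mulrAC !mulrA.
by apply: eq_bigr => pi _; rewrite -mulr_sumr color_sum mulrAC !mulrA.
Qed.

Lemma coloredA_eulerA (F : fieldType) (n r : nat) (x y s t p q : F) :
  (0 < r)%N -> y != 0 -> qnum r p != 0 ->
  coloredA n r x y s t p q =
    qnum r p ^+ n * y ^+ n *
    eulerA n (x / y) ((t + s * p * qnum r.-1 p) / (qnum r p * y)) q.
Proof.
case: r => // r _ y0 r0; rewrite coloredA_sum_perm /eulerA [RHS]mulr_sumr /=.
(* With [n] replaced by [a + b + c], each summand is a monomial identity: the denominators cancel
   [y ^+ (a + c)] and [z ^+ c], leaving [y ^+ b] and [z ^+ (a + b)]. *)
apply: eq_bigr => pi _; move: (exc_aexc_fix pi) (qnum r.+1 p) r0.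
move: (t + _) (exc pi) (aexc pi) (fix_ pi) (cyc pi) => u a b c d <- z z0.
rewrite !exprMn !exprVn !exprD !exprMn.
field.
by rewrite !expf_neq0.
Qed.

Theorem theorem47 (F : fieldType) (r n : nat) (hr : (0 < r)%N) (hn : (0 < n)%N) :
  (forall x y s t p q : F, y != 0 -> qnum r p != 0 ->
     coloredA n r x y s t p q =
       qnum r p ^+ n * y ^+ n *
       eulerA n (x / y) ((t + s * p * qnum r.-1 p) / (qnum r p * y)) q)
  /\
  (forall x t p q : F,
     \sum_(w : cperm r n)
        x ^+ cexc w * t ^+ cfix w * p ^+ csum w * q ^+ ccyc w
       = coloredA n r x 1 x t p q
     /\
     (qnum r p != 0 ->
        coloredA n r x 1 x t p q =
          qnum r p ^+ n *
          eulerA n x ((t + x * p * qnum r.-1 p) / qnum r p) q)).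
Proof.
split=> [x y s t p q|x t p q]; first exact: coloredA_eulerA.
split=> [|r0].
  by apply: eq_bigr => w _; rewrite /cexc expr1n mulr1 exprD.
by rewrite coloredA_eulerA ?oner_eq0 // expr1n !mulr1 divr1.
Qed.
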